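(* Let $C$ and $C'$ be smooth $d$-dimensional combinatorial cubes in $\mathbb{R}^d$ which are Minkowski equivalent. Then the pair $(C, C')$ is IDP, i.e. every lattice point of $C + C'$ is the sum of a lattice point of $C$ and a lattice point of $C'$.
   Context: A lattice polytope is the convex hull of finitely many points of $\mathbb{Z}^d$. A $d$-dimensional polytope is simple if each vertex lies in exactly $d$ edges. The primitive edge directions at a vertex are the smallest lattice vectors pointing along its incident edges. A $d$-dimensional lattice polytope in $\mathbb{R}^d$ is smooth if it is simple and at every vertex the primitive edge directions form a basis of $\mathbb{Z}^d$. A $d$-dimensional combinatorial cube is a polytope whose face poset is isomorphic to that of $[0,1]^d$. Two polytopes are Minkowski equivalent if they have the same normal fan. For lattice polytopes $P,Q$, the pair $(P,Q)$ is IDP if every lattice point of $P+Q$ is the sum of a lattice point of $P$ and a lattice point of $Q$. *)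

(* Defs.v *)
From HB Require Import structures.
From mathcomp Require Import all_boot all_order all_algebra.
From mathcomp Require Import classical_sets reals.
Set Implicit Arguments. Unset Strict Implicit. Unset Printing Implicit Defensive.
Import Order.TTheory GRing.Theory Num.Theory.
Local Open Scope ring_scope.
Local Open Scope classical_set_scope.

Section PolytopeDefs.
Variables (R : realType) (d : nat).
Local Notation pt := 'rV[R]_d.

Definition dotp (c x : pt) : R := \sum_(i < d) c 0 i * x 0 i.

Definition lattice_pt (x : pt) : Prop := forall i, x 0 i \is a Num.int.

Definition conv (V : seq pt) : set pt :=
  [set x | exists w : 'I_(size V) -> R,
     (forall i, 0 <= w i) /\ \sum_i w i = 1 /\ x = \sum_i w i *: V`_i].

Definition lattice_polytope (P : set pt) : Prop :=
  exists V : seq pt, (forall v, v \in V -> lattice_pt v) /\ P = conv V.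

Definition full_dim (P : set pt) : Prop :=
  exists (p0 : pt) (p : 'I_d -> pt), P p0 /\ (forall i, P (p i)) /\
    row_free (\matrix_(i < d, j < d) (p i - p0) 0 j).

(* (nonempty) faces: sets of maximizers of a linear functional (c = 0 gives P) *)
Definition face (P F : set pt) : Prop :=
  exists c : pt, F = [set x | P x /\ forall y, P y -> dotp c y <= dotp c x].

Definition vertex (P : set pt) (v : pt) : Prop := face P [set v].

Definition segment (u w : pt) : set pt :=
  [set x | exists t : R, 0 <= t <= 1 /\ x = (1 - t) *: u + t *: w].

Definition edge (P E : set pt) : Prop :=
  face P E /\ exists u w : pt, u != w /\ E = segment u w.

Definition enum_edges_at (P : set pt) (v : pt) (e : 'I_d -> set pt) : Prop :=
  injective e /\ (forall i, edge P (e i) /\ e i v) /\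
  (forall E, edge P E -> E v -> exists i, e i = E).

Definition simple (P : set pt) : Prop :=
  full_dim P /\ forall v, vertex P v -> exists e, enum_edges_at P v e.

Definition prim_edge_dir (E : set pt) (v u : pt) : Prop :=
  (exists w : pt, w != v /\ E = segment v w /\ exists2 l : R, 0 < l & u = l *: (w - v))
  /\ lattice_pt u /\ (forall m : R, 0 < m < 1 -> ~ lattice_pt (m *: u)).

Definition lattice_basis (u : 'I_d -> pt) : Prop :=
  (forall i, lattice_pt (u i)) /\
  row_free (\matrix_(i < d, j < d) u i 0 j) /\
  (forall x, lattice_pt x -> exists k : 'I_d -> int, x = \sum_i (k i)%:~R *: u i).

Definition smooth (P : set pt) : Prop :=
  lattice_polytope P /\ full_dim P /\ simple P /\
  forall v, vertex P v -> exists (e : 'I_d -> set pt) (u : 'I_d -> pt),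
    enum_edges_at P v e /\ (forall i, prim_edge_dir (e i) v (u i)) /\ lattice_basis u.

Definition face_poset_iso (P Q : set pt) : Prop :=
  exists f : set pt -> set pt,
    (forall F, face P F -> face Q (f F)) /\
    (forall G, face Q G -> exists2 F, face P F & f F = G) /\
    (forall F1 F2, face P F1 -> face P F2 -> (F1 `<=` F2 <-> f F1 `<=` f F2)).

Definition unit_cube : set pt := [set x | forall i, 0 <= x 0 i <= 1].

Definition comb_cube (P : set pt) : Prop := face_poset_iso P unit_cube.

Definition normal_cone (P F : set pt) : set pt :=
  [set c | forall x, F x -> forall y, P y -> dotp c y <= dotp c x].

Definition normal_fan (P : set pt) : set (set pt) :=
  [set K | exists2 F, face P F & K = normal_cone P F].

Definition minkowski_equiv (P Q : set pt) : Prop := normal_fan P = normal_fan Q.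

Definition msum (P Q : set pt) : set pt :=
  [set z | exists x y, P x /\ Q y /\ z = x + y].

Definition IDP_pair (P Q : set pt) : Prop :=
  forall z, lattice_pt z -> msum P Q z ->
    exists x y, lattice_pt x /\ lattice_pt y /\ P x /\ Q y /\ z = x + y.

End PolytopeDefs.

(* Main.v *)
(* At a vertex of a smooth cube the edge directions and the inner facet
   normals are dual lattice bases, and smoothness makes the normal [nu i b] of
   the facet "coordinate i = b" the same at all its vertices. Writing the
   normals [nu i true] in the basis [nu j false] gives an integer matrix; a
   chordless cycle among its off-diagonal entries would contradict the existence
   of the lattice basis at some vertex, so the matrix is triangular for some
   order of the coordinates (the fan is that of a Bott tower). Hence both
   polytopes have the form [l i <= x_i <= r i + linear in earlier coordinates],
   with the same linear part and integral bounds, and every prefix satisfying its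
   inequalities extends to a point. A lattice point of the sum is then decomposed
   greedily, one coordinate at a time. *)
Require Import Defs.
From mathcomp Require Import all_boot all_order all_algebra.
From mathcomp Require Import classical_sets reals.
From mathcomp Require Import boolp.
From mathcomp Require Import ring lra.
Set Implicit Arguments. Unset Strict Implicit. Unset Printing Implicit Defensive.
Import Order.TTheory GRing.Theory Num.Theory.
Local Open Scope ring_scope.
Local Open Scope classical_set_scope.

(** * Bilinearity and definiteness of the dot product *)

Section Dotp.
Variables (R : realType) (d : nat).
Implicit Types (a b c x y : 'rV[R]_d) (t : R).

Lemma dotpC c x : dotp c x = dotp x c.
Proof. by apply: eq_bigr => i _; rewrite mulrC. Qed.

Lemma dotpDr c x y : dotp c (x + y) = dotp c x + dotp c y.
Proof. by rewrite -big_split; apply: eq_bigr => i _; rewrite mxE mulrDr. Qed.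

Lemma dotpZr t c x : dotp c (t *: x) = t * dotp c x.
Proof. by rewrite mulr_sumr; apply: eq_bigr => i _; rewrite mxE mulrCA. Qed.

Lemma dotpNr c x : dotp c (- x) = - dotp c x.
Proof. by rewrite -scaleN1r dotpZr mulN1r. Qed.

Lemma dotpBr c x y : dotp c (x - y) = dotp c x - dotp c y.
Proof. by rewrite dotpDr dotpNr. Qed.

Lemma dotp0r c : dotp c 0 = 0.
Proof. by rewrite -(scale0r c) dotpZr mul0r. Qed.

Lemma dotpDl a b x : dotp (a + b) x = dotp a x + dotp b x.
Proof. by rewrite !(dotpC _ x) dotpDr. Qed.

Lemma dotpZl t a x : dotp (t *: a) x = t * dotp a x.
Proof. by rewrite !(dotpC _ x) dotpZr. Qed.

Lemma dotpNl a x : dotp (- a) x = - dotp a x.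
Proof. by rewrite !(dotpC _ x) dotpNr. Qed.

Lemma dotpBl a b x : dotp (a - b) x = dotp a x - dotp b x.
Proof. by rewrite !(dotpC _ x) dotpBr. Qed.

Lemma dotp0l x : dotp 0 x = 0.
Proof. by rewrite dotpC dotp0r. Qed.

Lemma dotp_sumr (I : finType) (F : I -> 'rV[R]_d) c :
  dotp c (\sum_i F i) = \sum_i dotp c (F i).
Proof. exact: (big_morph (dotp c) (dotpDr c) (dotp0r c)). Qed.

Lemma dotp_self_eq0 x : dotp x x <= 0 -> x = 0.
Proof.
move=> le0; have sq i : 0 <= x 0 i * x 0 i by rewrite -expr2 sqr_ge0.
have /eqP : dotp x x = 0 by apply/eqP; rewrite eq_le le0 sumr_ge0.
rewrite psumr_eq0 // => /allP x0; apply/rowP => i; rewrite mxE.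
by have := x0 i (mem_index_enum _); rewrite /= mulf_eq0 orbb => /eqP.
Qed.

End Dotp.

Definition dotpE := (dotpDr, dotpDl, dotpNr, dotpNl, dotpZr, dotpZl, dotp0r, dotp0l).

Lemma dotp_row_mx (R : realType) n (c x : 'rV[R]_n) (k s : 'M[R]_1) :
  dotp (row_mx c k) (row_mx x s) = dotp c x + k 0 0 * s 0 0.
Proof.
rewrite /dotp big_split_ord big_ord1 /= row_mxEr row_mxEr; congr (_ + _).
by apply: eq_bigr => i _; rewrite !row_mxEl.
Qed.

(** * Finitely generated cones and Farkas' lemma *)

Section Cone.
Variables (R : realType) (n : nat).
Implicit Types (W : seq 'rV[R]_n) (a b c x : 'rV[R]_n).

(** Nonnegative combinations, with one coefficient peeled off per generator so that proofs go by
    induction on the list without indexed sums. *)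
Fixpoint incone W b : Prop :=
  if W is a :: W' then exists2 t, 0 <= t & incone W' (b - t *: a) else b = 0.

Lemma incone0 W : incone W 0.
Proof. by elim: W => //= a W IH; exists 0; rewrite // scale0r subr0. Qed.

Lemma inconeD W b c : incone W b -> incone W c -> incone W (b + c).
Proof.
elim: W b c => [|a W IH] b c /=; first by move=> -> ->; rewrite addr0.
move=> [s s0 hb] [t t0 hc]; exists (s + t); first by rewrite addr_ge0.
have -> : b + c - (s + t) *: a = (b - s *: a) + (c - t *: a).
  by rewrite scalerDl opprD addrACA.
exact: IH.
Qed.

Lemma inconeZ W r b : 0 <= r -> incone W b -> incone W (r *: b).
Proof.
move=> r0; elim: W b => [|a W IH] b /=; first by move=> ->; rewrite scaler0.
move=> [t t0 hb]; exists (r * t); first by rewrite mulr_ge0.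
by rewrite -scalerA -scalerBr; apply: IH.
Qed.

Lemma incone_sum (I : finType) (F : I -> 'rV[R]_n) W :
  (forall i, incone W (F i)) -> incone W (\sum_i F i).
Proof. by move=> hF; apply: big_ind => //; [exact: incone0|exact: inconeD]. Qed.

Lemma mem_incone W w : w \in W -> incone W w.
Proof.
elim: W => //= a W IH; rewrite in_cons => /orP[/eqP->|/IH hw].
  by exists 1; rewrite // scale1r subrr; exact: incone0.
by exists 0; rewrite // scale0r subr0.
Qed.

Lemma incone_sub W W' b :
  incone W b -> (forall w, w \in W -> incone W' w) -> incone W' b.
Proof.
elim: W b => [|a W IH] b /=; first by move=> -> _; exact: incone0.
move=> [t t0 hb] hW; rewrite -(subrK (t *: a) b); apply: inconeD.
  by apply: IH => // w wW; apply: hW; rewrite in_cons wW orbT.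
by apply: inconeZ => //; apply: hW; rewrite mem_head.
Qed.

Lemma incone_dotp_le0 W b c :
  incone W b -> (forall w, w \in W -> dotp c w <= 0) -> dotp c b <= 0.
Proof.
elim: W b => [|a W IH] b /=; first by move=> -> _; rewrite dotp0r.
move=> [t t0 hb] hW; rewrite -(subrK (t *: a) b) !dotpE.
have := hW a (mem_head _ _); have := IH _ hb; rewrite !dotpE => h1 h2.
have {}h1 : dotp c b - t * dotp c a <= 0.
  by apply: h1 => w wW; apply: hW; rewrite in_cons wW orbT.
by nra.
Qed.

(** Undoes a projection along [a]: the multiples of [a] removed from the generators add up to [s], a
    sum of terms [t * g w] with [t >= 0]. *)
Lemma incone_shift W (g : 'rV[R]_n -> R) a b :
  (forall w, w \in W -> g w <= 0) ->
  incone [seq w - g w *: a | w <- W] b ->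
  exists2 s, s <= 0 & incone W (b + s *: a).
Proof.
elim: W b => [|w W IH] b hg /=.
  by move=> ->; exists 0; rewrite // scale0r addr0.
move=> [t t0] /IH[|s s0 hs]; first by move=> x xW; apply: hg; rewrite in_cons xW orbT.
have gw := hg w (mem_head _ _).
exists (s + t * g w); first by nra.
exists t => //; congr (incone W _): hs.
by apply/rowP => i; rewrite !mxE; ring.
Qed.

(* Bartl's induction: if the first generator [a] is needed, some [x0] satisfies
   the other constraints and violates [b x <= 0]; project along it. *)
Lemma farkas W b :
  (forall x, (forall w, w \in W -> dotp w x <= 0) -> dotp b x <= 0) ->
  incone W b.
Proof.
have [m] := ubnP (size W); elim: m W b => // m IH [|a W] b /= szW hb.
  by apply: dotp_self_eq0; apply: hb.
have [hWb|] := pselect (forall x, (forall w, w \in W -> dotp w x <= 0) -> dotp b x <= 0).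
  by exists 0 => //; rewrite scale0r subr0; apply: IH.
move=> /existsNP[x1] /not_implyP[Wx1 /negP]; rewrite -ltNge => bx1.
have ax1 : 0 < dotp a x1.
  rewrite ltNge; apply/negP => ax1; have : dotp b x1 <= 0.
    by apply: hb => w; rewrite in_cons => /orP[/eqP->|/Wx1].
  by rewrite leNgt bx1.
pose x0 := (dotp a x1)^-1 *: x1.
have ax0 : dotp a x0 = 1 by rewrite dotpZr mulVf ?gt_eqF.
have bx0 : 0 < dotp b x0 by rewrite dotpZr mulr_gt0 ?invr_gt0.
have Wx0 w : w \in W -> dotp w x0 <= 0.
  by move=> /Wx1 wx; rewrite dotpZr mulr_ge0_le0 // invr_ge0 ltW.
move: x0 ax0 bx0 Wx0 => x0 ax0 bx0 Wx0.
have [||s s0 hs] := @incone_shift W (fun w => dotp w x0) a (b - dotp b x0 *: a) => //.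
  apply: IH; first by rewrite size_map.
  (* [y] is [x] moved along [x0] into the hyperplane orthogonal to [a]; pairing with [y] is pairing
     the projected vectors with [x]. *)
  move=> x hx; pose y := x - dotp a x *: x0.
  have shift c : dotp (c - dotp c x0 *: a) x = dotp c y by rewrite !dotpE; ring.
  rewrite shift; apply: hb => w; rewrite in_cons => /orP[/eqP->|wW].
    by rewrite !dotpE ax0 mulr1 subrr.
  by rewrite -shift; apply/hx/map_f.
exists (dotp b x0 - s); first by lra.
congr (incone W _): hs; by apply/rowP => i; rewrite !mxE; ring.
Qed.

(* Discarding redundant generators leaves a list in which each [w] is cut off
   from the others by some [c]; tilting [c] by [c0] makes it vanish at [w]. *)
Lemma exposed_generators W c0 :
  (forall w, w \in W -> dotp c0 w < 0) ->
  exists W', [/\ {subset W' <= W}, forall w, w \in W -> incone W' w &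
    forall w, w \in W' -> exists2 c, dotp c w = 0 &
      forall w', w' \in W' -> w' != w -> dotp c w' < 0].
Proof.
have [m] := ubnP (size W); elim: m W => // m IH W szW hc0.
have [[w wW hw]|irr] := pselect (exists2 w, w \in W & incone (rem w W) w).
  have subW : {subset rem w W <= W} by exact: mem_rem.
  have [||W' [W'W gen ex]] := IH (rem w W).
  - by rewrite size_rem // prednK //; case: (W) wW.
  - by move=> x /subW; exact: hc0.
  exists W'; split => //; first by move=> x /W'W /subW.
  move=> x xW; have genw : incone W' w by apply: incone_sub hw gen.
  have [->//|xw] := eqVneq x w; apply: gen.
  have := perm_to_rem wW => /perm_mem/(_ x); rewrite xW in_cons (negPf xw) /=.
  by move=> <-.
exists W; split => // [w|w wW]; first exact: mem_incone.
have [hinc|] := pselect (incone (rem w W) w); first by case: irr; exists w.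
move=> /(contra_not (@farkas _ _)) /existsNP[c] /not_implyP[cW /negP].
rewrite -ltNge => cw; have c0w := hc0 w wW.
exists (c - (dotp c w / dotp c0 w) *: c0).
  by rewrite !dotpE dotpC -mulrA mulVf ?lt_eqF // mulr1 subrr.
move=> w' w'W w'w; rewrite !dotpE.
have : dotp c w' <= 0.
  rewrite dotpC; apply: cW.
  by have := perm_to_rem wW => /perm_mem/(_ w'); rewrite w'W in_cons (negPf w'w).
have : dotp c w / dotp c0 w < 0 by rewrite pmulr_rlt0 ?invr_lt0 // dotpC.
by have := hc0 _ w'W; nra.
Qed.

End Cone.

(** * Exposed rays and maximizers over lists *)

Section Ray.
Variables (R : realType) (n : nat).
Implicit Types (W : seq 'rV[R]_n) (a b c w : 'rV[R]_n).

(** Since [c] is negative on every generator other than [w], those must have coefficient zero in a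
    combination on which [c] vanishes. *)
Lemma incone_ray W c w b :
  dotp c w = 0 -> (forall w', w' \in W -> w' != w -> dotp c w' < 0) ->
  incone W b -> dotp c b = 0 -> exists2 l, 0 <= l & b = l *: w.
Proof.
move=> cw; elim: W b => [|a W IH] b hW /=.
  by move=> -> _; exists 0; rewrite ?scale0r.
move=> [t t0 hb] cb.
have hW' w' : w' \in W -> w' != w -> dotp c w' < 0.
  by move=> w'W; apply: hW; rewrite in_cons w'W orbT.
have le1 : dotp c (b - t *: a) <= 0.
  apply: incone_dotp_le0 hb _ => w' w'W.
  by have [->|/hW' -/(_ w'W)/ltW//] := eqVneq w' w; rewrite cw.
have := hW a (mem_head _ _).
have [ea _|_ /(_ isT) ca] := eqVneq a w.
  have [|l l0 e] := IH _ hW' hb; first by rewrite ea !dotpE cb cw mulr0 subrr.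
  exists (l + t); first exact: addr_ge0.
  by rewrite scalerDl -e ea subrK.
have t00 : t = 0 by move: le1; rewrite !dotpE cb; nra.
by apply: IH => //; rewrite ?t00 ?scale0r ?subr0 // in hb.
Qed.

End Ray.

Lemma seq_argmax (R : realDomainType) (T : eqType) (F : T -> R) (s : seq T) x0 :
  x0 \in s -> exists2 x, x \in s & forall y, y \in s -> F y <= F x.
Proof.
elim: s x0 => // a [|b s] IH x0 _.
  by exists a; rewrite ?mem_head // => y; rewrite inE => /eqP->.
have [x xs hx] := IH b (mem_head _ _).
have [le|lt] := leP (F a) (F x).
  exists x; first by rewrite in_cons xs orbT.
  by move=> y; rewrite in_cons => /orP[/eqP->|/hx].
exists a; rewrite ?mem_head // => y; rewrite in_cons => /orP[/eqP->//|/hx/le_trans].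
by apply; exact: ltW.
Qed.

(** * Convex hulls, separation and existence of vertices *)

Section Conv.
Variables (R : realType) (d : nat).
Implicit Types (V : seq 'rV[R]_d) (K : set 'rV[R]_d) (a b c v x y : 'rV[R]_d).

Definition convex_set K : Prop :=
  forall x y t, 0 <= t <= 1 -> K x -> K y -> K ((1 - t) *: x + t *: y).

(** Lifting to height 1 turns affine statements about hulls into linear ones about cones, where
    [farkas] applies. *)
Definition homog x : 'rV[R]_(d + 1) := row_mx x 1.

Lemma dotp_homog c k x : dotp (row_mx c k%:M) (homog x) = dotp c x + k.
Proof. by rewrite dotp_row_mx !mxE mulr1. Qed.

Lemma mem_conv V v : v \in V -> conv V v.
Proof.
move=> vV; have iV : (index v V < size V)%N by rewrite index_mem.
exists (fun i => (i == Ordinal iV)%:R); split=> [i|]; first exact: ler0n.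
split.
  by rewrite (bigD1 (Ordinal iV)) //= eqxx big1 ?addr0 // => i /negPf->.
rewrite (bigD1 (Ordinal iV)) //= eqxx big1 => [|i /negPf->]; last by rewrite scale0r.
by rewrite addr0 scale1r nth_index.
Qed.

Lemma conv_nonempty V x : conv V x -> V != [::].
Proof.
case: V => // -[w [_ [/eqP]]].
by rewrite big_ord0 eq_sym oner_eq0.
Qed.

Lemma conv_convex V : convex_set (conv V).
Proof.
move=> x y t /andP[t0 t1] [w [w0 [w1 ->]]] [w' [w'0 [w'1 ->]]].
exists (fun i => (1 - t) * w i + t * w' i); split=> [i|].
  by rewrite addr_ge0 // mulr_ge0 // subr_ge0.
rewrite big_split -!mulr_sumr /= w1 w'1; split; first by ring.
rewrite !scaler_sumr -big_split; apply: eq_bigr => i _.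
by rewrite /= !scalerA -scalerDl.
Qed.

Lemma conv_in_cone V p W x :
  (forall v, v \in V -> incone W (v - p)) -> conv V x -> incone W (x - p).
Proof.
move=> hV [w [w0 [w1 ->]]]; rewrite -[p]scale1r -w1 scaler_suml -sumrB.
by apply: incone_sum => i; rewrite -scalerBr; apply/inconeZ/hV/mem_nth.
Qed.

Lemma conv_homog V W x :
  (forall v, v \in V -> incone W (homog v)) -> conv V x -> incone W (homog x).
Proof.
move=> hV [w [w0 [w1 ->]]].
suff -> : homog (\sum_i w i *: V`_i) = \sum_i w i *: homog V`_i.
  by apply: incone_sum => i; apply/inconeZ/hV/mem_nth.
have -> : \sum_i w i *: homog V`_i = \sum_i row_mx (w i *: V`_i) (w i)%:M.
  by apply: eq_bigr => i _; rewrite scale_row_mx scale_scalar_mx mulr1.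
apply/rowP => j; rewrite summxE mxE; case: split_ordP => k ->.
  by rewrite summxE; apply: eq_bigr => i _; rewrite row_mxEl.
rewrite (ord1 k) mxE /= -w1; apply: eq_bigr => i _.
by rewrite row_mxEr mxE.
Qed.

(** A convex combination reaching the upper bound [k] of [c] puts weight only on generators that
    reach it too. *)
Lemma conv_face_dotp_le V c g k m x :
  conv V x -> (forall v, v \in V -> dotp c v <= k) -> dotp c x = k ->
  (forall v, v \in V -> dotp c v = k -> dotp g v <= m) -> dotp g x <= m.
Proof.
move=> [w [w0 [w1 ->]]] hV hk hg.
have z : \sum_i w i * (k - dotp c V`_i) = 0.
  have : \sum_i w i * k - dotp c (\sum_i w i *: V`_i) = 0.
    by rewrite hk -mulr_suml w1 mul1r subrr.
  rewrite dotp_sumr -sumrB => {2}<-.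
  by apply: eq_bigr => i _; rewrite dotpZr mulrBr.
rewrite dotp_sumr -[m]mul1r -w1 mulr_suml; apply: ler_sum => i _.
rewrite dotpZr; have Vi : V`_i \in V by exact: mem_nth.
have /eqP : w i * (k - dotp c V`_i) = 0.
  apply/eqP; have /eqP := z; rewrite psumr_eq0 => [/allP/(_ i)|j _].
    by apply; exact: mem_index_enum.
  by rewrite mulr_ge0 // subr_ge0 hV // mem_nth.
rewrite mulf_eq0 => /orP[/eqP->|]; first by rewrite !mul0r.
by rewrite subr_eq0 eq_sym => /eqP /(hg _ Vi); exact: ler_wpM2l.
Qed.

Lemma incone_homog_scaled V K x s :
  convex_set K -> (forall v, v \in V -> K v) ->
  incone (map homog V) (row_mx x s%:M) ->
  (s = 0 /\ x = 0) \/ (0 < s /\ K (s^-1 *: x)).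
Proof.
move=> cK; elim: V x s => [|a V IH] x s hK /=.
  rewrite -row_mx0 => /eq_row_mx[-> /(congr1 (fun A : 'M_1 => A 0 0))].
  by rewrite !mxE /= mulr1n => ->; left.
move=> [t t0]; rewrite /homog scale_row_mx opp_row_mx add_row_mx.
rewrite scale_scalar_mx mulr1 -scalar_mx_is_additive => /IH [].
- by move=> v vV; apply: hK; rewrite in_cons vV orbT.
- move=> [/eqP]; rewrite subr_eq0 => /eqP-> /eqP; rewrite subr_eq0 => /eqP->.
  have [->|tn0] := eqVneq t 0; first by left; rewrite scale0r.
  right; split; first by rewrite lt_def tn0.
  by rewrite scalerA mulVf // scale1r; apply: hK; rewrite mem_head.
move=> [st0 hx]; right.
have s0 : 0 < s by lra.
split => //.
(* The rescaled point is a two-point convex combination of [a] and the rescaled remainder, which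
   lies in [K] by induction. *)
have -> : s^-1 *: x = (1 - t / s) *: ((s - t)^-1 *: (x - t *: a)) + (t / s) *: a.
  apply/rowP => i; rewrite !mxE; field; rewrite !gt_eqF //.
apply: cK => //; last by apply: hK; rewrite mem_head.
by rewrite divr_ge0 ?(ltW s0) //= ler_pdivrMr // mul1r; lra.
Qed.

(** Farkas' lemma at height 1: a point that no functional separates from [V] lies in its hull. The
    set [K] is left arbitrary so that a property can be spread from finitely many points to their
    hull. *)
Lemma convex_separation V K x :
  convex_set K -> (forall v, v \in V -> K v) ->
  (forall c, exists2 v, v \in V & dotp c x <= dotp c v) -> K x.
Proof.
move=> cK hK hx; have : incone (map homog V) (homog x).
  apply: farkas => y hy.
  have ey : y = row_mx (lsubmx y) (rsubmx y 0 0)%:M.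
    by rewrite -mx11_scalar hsubmxK.
  have [v vV] := hx (lsubmx y); have := hy _ (map_f homog vV).
  by rewrite !(dotpC _ y) ey !dotp_homog -ey; lra.
rewrite /homog -[1]/(1%:M) => /(incone_homog_scaled cK hK) [[/eqP]|[_]].
  by rewrite oner_eq0.
by rewrite invr1 scale1r.
Qed.

(** Irredundant generators of the cone over [V] span exposed rays, that is, lifted vertices; a
    maximizer among them is a maximizer on the whole hull. *)
Lemma face_attains_vertex V c :
  V != [::] -> exists v, [/\ v \in V, vertex (conv V) v &
    forall y, conv V y -> dotp c y <= dotp c v].
Proof.
(* The functional [row_mx 0 (-1)%:M] is minus the height, hence negative on every lifted point. *)
move=> Vn0; have [|W' [W'V gen ex]] :=
    @exposed_generators R _ (map homog V) (row_mx 0 (-1)%:M).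
  by move=> w /mapP[v _ ->]; rewrite dotp_homog dotp0l add0r ltrN10.
have genP y : conv V y -> incone W' (homog y).
  by apply: conv_homog => v vV; apply/gen/map_f.
have [w0 w0W'] : exists w0, w0 \in W'.
  case: W' {W'V ex genP} gen => [|w W'] gen; last by exists w; rewrite mem_head.
  case: V Vn0 gen => // v V _ /(_ (homog v)); rewrite mem_head => /(_ isT) /=.
  move=> /(congr1 (dotp (row_mx 0 1%:M))).
  by rewrite dotp_homog dotp0l dotp0r add0r => /eqP; rewrite oner_eq0.
have [w wW' wmax] := seq_argmax (fun w => dotp (row_mx c 0%:M) w) w0W'.
have /mapP[v vV ew] := W'V _ wW'; rewrite {}ew in wW' wmax.
exists v; split => //; last first.
  move=> y Py; have := incone_dotp_le0 (c := row_mx c (- dotp c v)%:M) (genP y Py).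
  rewrite dotp_homog subr_le0; apply => w' w'W'; have := wmax _ w'W'.
  have /mapP[v' _ ->] := W'V _ w'W'.
  by rewrite !dotp_homog !addr0 subr_le0.
have [c1 c1v c1lt] := ex _ wW'.
have e1 : c1 = row_mx (lsubmx c1) (rsubmx c1 0 0)%:M by rewrite -mx11_scalar hsubmxK.
have le0 y : conv V y -> dotp c1 (homog y) <= 0.
  move=> /genP/incone_dotp_le0; apply => w' w'W'.
  by have [->|/c1lt-/(_ w'W')/ltW//] := eqVneq w' (homog v); rewrite c1v.
have e y : dotp c1 (homog y) = dotp (lsubmx c1) y + rsubmx c1 0 0.
  by rewrite -dotp_homog -e1.
exists (lsubmx c1); apply/seteqP; split => [x ->|x [Px /(_ v (mem_conv vV)) hx]] /=.
  split; first exact: mem_conv.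
  by move=> y /le0; move: c1v; rewrite !e; lra.
case: (incone_ray c1v c1lt (genP _ Px)).
  by move: c1v (le0 _ Px); rewrite !e; lra.
move=> l l0; rewrite /homog scale_row_mx => /eq_row_mx[-> /(congr1 (fun A : 'M_1 => A 0 0))].
by rewrite !mxE /= mulr1 => <-; rewrite scale1r.
Qed.

End Conv.

(** * Dual lattice bases and the cone of a smooth polytope at a vertex *)

Section VertexCone.
Variables (R : realType) (d : nat).
Implicit Types (V : seq 'rV[R]_d) (P : set 'rV[R]_d) (c v w x y : 'rV[R]_d).
Implicit Types (u n : 'I_d -> 'rV[R]_d).

Definition dual_bases n u : Prop :=
  (forall i j, dotp (n i) (u j) = (i == j)%:R) /\
  (forall x, x = \sum_i dotp (n i) x *: u i).

Definition integral_form c : Prop :=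
  forall x, lattice_pt x -> dotp c x \is a Num.int.

Definition dual_lattice_bases n u : Prop :=
  [/\ dual_bases n u, forall i, lattice_pt (u i) & forall i, integral_form (n i)].

(** The dual functionals are the columns of the inverse of the matrix with rows [u i]. *)
Lemma exists_dual_basis u :
  row_free (\matrix_(i < d, j < d) u i 0 j) -> exists n, dual_bases n u.
Proof.
set M := \matrix_(i, j) _ => freeM.
have uM : M \in unitmx by rewrite -row_free_unit.
have nE x i : dotp ((col i (invmx M))^T) x = (x *m invmx M) 0 i.
  by rewrite mxE; apply: eq_bigr => j _; rewrite !mxE mulrC.
have uE j : u j = row j M by apply/rowP => k; rewrite !mxE.
exists (fun i => (col i (invmx M))^T); split => [i j|x].
  by rewrite nE uE -row_mul mulmxV // row1 !mxE eqxx eq_sym.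
rewrite -{1}[x](mulmxKV uM) mulmx_sum_row.
by apply: eq_bigr => i _; rewrite nE uE.
Qed.

Lemma lattice_basis_dual_integral n u :
  dual_bases n u -> lattice_basis u -> forall i, integral_form (n i).
Proof.
move=> [nu _] [_ [_ span]] i x /span[k ->].
rewrite dotp_sumr (bigD1 i) //= dotpZr nu eqxx mulr1 big1 ?addr0.
  exact: intr_int.
by move=> j ji; rewrite dotpZr nu eq_sym (negPf ji) mulr0.
Qed.

Lemma vertex_mem V v : vertex (conv V) v -> v \in V.
Proof.
move=> [c vE]; have Vv : conv V v by move/seteqP: vE => [/(_ v erefl)[]].
have [v' [v'V _ hv']] := face_attains_vertex c (conv_nonempty Vv).
suff <- : v' = v by [].
by move/seteqP: vE => [_ /(_ v')]; apply; split => //; exact: mem_conv.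
Qed.

Lemma vertex_exposed P v :
  vertex P v -> exists c, forall x, P x -> x != v -> dotp c x < dotp c v.
Proof.
move=> [c vE]; exists c => x Px; apply: contraNlt => le; apply/eqP.
have [Pv hv] : P v /\ forall y, P y -> dotp c y <= dotp c v.
  by move/seteqP: vE => [/(_ v erefl)].
move/seteqP: vE => [_ /(_ x)]; apply; split => // y Py.
exact: le_trans (hv y Py) le.
Qed.

(* An irredundant generating set of the cone of [conv V] at [v] spans rays that
   are exposed, hence lie along edges. *)
Lemma vertex_cone V v (e : 'I_d -> set 'rV[R]_d) u n :
  vertex (conv V) v -> enum_edges_at (conv V) v e ->
  (forall i, prim_edge_dir (e i) v (u i)) -> dual_bases n u ->
  forall x k, conv V x -> 0 <= dotp (n k) (x - v).
Proof.
move=> vv [_ [_ all_edges]] prim [nu _].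
have vV := vertex_mem vv; have Vv := mem_conv vV.
have [c0 c0v] := vertex_exposed vv.
pose W := [seq w - v | w <- V & w != v].
have [|W' [W'W gen ex]] := @exposed_generators _ _ W c0.
  move=> w0 /mapP[w]; rewrite mem_filter => /andP[wv wV] ->.
  by rewrite dotpBr subr_lt0 c0v //; exact: mem_conv.
have genP x : conv V x -> incone W' (x - v).
  apply: conv_in_cone => w wV; have [->|wv] := eqVneq w v.
    by rewrite subrr; exact: incone0.
  by apply/gen/map_f; rewrite mem_filter wv.
suff W'u w' k : w' \in W' -> 0 <= dotp (n k) w'.
  move=> x k Vx; have := incone_dotp_le0 (c := - n k) (genP _ Vx).
  rewrite dotpNl oppr_le0; apply => w' /W'u.
  by rewrite dotpNl oppr_le0; apply.
move=> w'W'; have /mapP[w] := W'W _ w'W'.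
rewrite mem_filter => /andP[wv wV] ew.
have [c cw clt] := ex _ w'W'.
have le0 x : conv V x -> dotp c x <= dotp c v.
  move=> Vx; have := incone_dotp_le0 (c := c) (genP _ Vx).
  rewrite dotpBr subr_le0; apply => w'' w''W'.
  by have [->|/clt-/(_ w''W')/ltW//] := eqVneq w'' w'; rewrite cw.
pose F : set 'rV[R]_d := [set x | conv V x /\ forall y, conv V y -> dotp c y <= dotp c x].
have FE x : F x <-> conv V x /\ dotp c x = dotp c v.
  split=> [[Vx hx]|[Vx hx]]; split=> //.
    by apply/eqP; rewrite eq_le le0 // hx.
  by move=> y /le0; rewrite hx.
have ray x : F x -> exists2 l, 0 <= l & x - v = l *: w'.
  move=> /FE[Vx cx]; apply: (incone_ray cw clt (genP _ Vx)).
  by rewrite dotpBr cx subrr.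
have w'n0 : w' != 0 by rewrite ew subr_eq0.
have ww' : 0 < dotp w' w'.
  by rewrite ltNge; apply/negP => /dotp_self_eq0/eqP; rewrite (negPf w'n0).
have Fw : F w.
  apply/FE; split; first exact: mem_conv.
  by move: cw; rewrite ew dotpBr => /eqP; rewrite subr_eq0 => /eqP.
(* [z] is the generator in [F] farthest along [w']; it will be the second endpoint of the edge. *)
have [z zV' zmax] : exists2 z, z \in [seq z <- V | dotp c z == dotp c v] &
    forall y, y \in [seq z <- V | dotp c z == dotp c v] -> dotp w' y <= dotp w' z.
  apply: (@seq_argmax _ _ (dotp w') _ w); rewrite mem_filter wV andbT.
  by apply/eqP; case/FE: Fw.
move: zV'; rewrite mem_filter => /andP[/eqP cz zV].
have Fz : F z by apply/FE; split => //; exact: mem_conv.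
have zmaxF x : F x -> dotp w' x <= dotp w' z.
  move=> /FE[Vx cx]; apply: (conv_face_dotp_le Vx _ cx) => y yV.
    by apply/le0/mem_conv.
  by move=> cy; apply: zmax; rewrite mem_filter yV cy eqxx.
have [m m0 ez] := ray _ Fz.
have mge x l : F x -> x - v = l *: w' -> l <= m.
  move=> /zmaxF; rewrite -(lerD2r (- dotp w' v)) -!dotpBr ez => + ex'.
  by rewrite ex' !dotpZr ler_pM2r.
(* The point [w] is [v + w'], so [z] lies at least as far out and differs from [v]. *)
have m1 : 1 <= m by apply: mge Fw _; rewrite scale1r ew.
have Fedge : edge (conv V) F.
  split; first by exists c.
  exists v, z; split.
    apply/eqP => evz; move/eqP: ez; rewrite evz subrr eq_sym scaler_eq0 (negPf w'n0) orbF.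
    by move/eqP => m00; move: m1; rewrite m00 ler10.
  apply/seteqP; split => [x Fx|x [t [/andP[t0 t1] ->]]].
    have [l l0 exv] := ray _ Fx; have lm := mge _ _ Fx exv.
    have mgt0 : 0 < m by lra.
    exists (l / m); split.
      by rewrite divr_ge0 // ler_pdivrMr // mul1r.
    rewrite -[LHS](subrK v) exv -[z](subrK v) ez.
    by apply/rowP => i; rewrite !mxE; field; rewrite gt_eqF.
  apply/FE; split.
    by apply: conv_convex => //; [rewrite t0|exact: mem_conv].
  by rewrite !dotpE cz; ring.
(* [F] is one of the listed edges, so [w'] is a nonnegative multiple of some [u i], on which [n k]
   is 0 or 1. *)
have [i ei] := all_edges F Fedge (proj2 (FE v) (conj Vv erefl)).
have [[w1 [w1v [e1 [l l0 el]]]] _] := prim i.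
have : segment v w1 w by rewrite -e1 ei.
move=> [t [/andP[t0 _] et]].
have -> : w' = (t / l) *: u i.
  by rewrite ew et el; apply/rowP => j; rewrite !mxE; field; rewrite gt_eqF.
by rewrite dotpZr nu mulr_ge0 ?divr_ge0 // ?ler0n // ltW.
Qed.

Lemma edge_dir_point P E v w :
  face P E -> prim_edge_dir E v w ->
  exists p t, [/\ P p, 0 < t & p - v = t *: w].
Proof.
move=> [c EE] [[p [pv [Ep [l l0 ->]]]] _]; exists p, l^-1; split.
- have : E p by rewrite Ep; exists 1; rewrite ler01 lexx subrr scale0r add0r scale1r.
  by rewrite EE => -[].
- by rewrite invr_gt0.
- by rewrite scalerA mulVf ?scale1r // gt_eqF.
Qed.

Lemma smooth_vertex V v :
  smooth (conv V) -> vertex (conv V) v ->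
  exists n u, [/\ dual_lattice_bases n u,
    forall x k, conv V x -> 0 <= dotp (n k) (x - v) &
    forall i, exists p t, [/\ conv V p, 0 < t & p - v = t *: u i]].
Proof.
move=> [_ [_ [_ sm]]] vv; have [e [u [edges [prim basis]]]] := sm v vv.
have [n nu] := exists_dual_basis (proj1 (proj2 basis)).
exists n, u; split => //.
- split => //; first by case: basis.
  exact: lattice_basis_dual_integral nu basis.
- exact: vertex_cone vv edges prim nu.
- move=> i; have [_ [/(_ i) [[Pe _] _] _]] := edges.
  exact: edge_dir_point Pe (prim i).
Qed.

End VertexCone.

(** * Vertices and facets of the unit cube *)

Section UnitCube.
Variables (R : realType) (d : nat).
Implicit Types (e : {set 'I_d}) (i j k : 'I_d) (b : bool) (x y : 'rV[R]_d).
Implicit Type F : set 'rV[R]_d.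
Local Notation cube := (@unit_cube R d).

(** Subsets of the coordinates label the vertices of the cube; [flip k] goes to the neighbour across
    the edge in direction [k]. *)
Definition flip k e : {set 'I_d} := [set j | (j \in e) (+) (j == k)]%SET.

Lemma in_flip k e j : (j \in flip k e) = (j \in e) (+) (j == k).
Proof. by rewrite inE. Qed.

Lemma flipK k : involutive (flip k).
Proof. by move=> e; apply/setP => j; rewrite !in_flip -addbA addbb addbF. Qed.

Definition cube_pt e : 'rV[R]_d := \row_i (i \in e)%:R.

Definition cube_facet i b : set 'rV[R]_d := [set x | cube x /\ x 0 i = b%:R].

Lemma unit_cube_pt e : cube (cube_pt e).
Proof. by move=> i; rewrite mxE; case: (i \in e); rewrite lexx ler01. Qed.

Lemma dotp_cube_pt_flip c k e :
  dotp c (cube_pt (flip k e)) = dotp c (cube_pt e) + (-1) ^+ (k \in e) * c 0 k.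
Proof.
rewrite {1}/dotp (bigD1 k) //= [dotp c (cube_pt e)](bigD1 k) //= addrAC.
congr (_ + _); last first.
  by apply: eq_bigr => j jk; rewrite !mxE in_flip (negPf jk) addbF.
by rewrite !mxE in_flip eqxx addbT; case: (k \in e); rewrite /= ?expr1 ?expr0; ring.
Qed.

Lemma face_cube_pt e : face cube [set cube_pt e].
Proof.
pose c : 'rV[R]_d := \row_i (if i \in e then 1 else -1).
have ge0 x i : cube x -> 0 <= c 0 i * (cube_pt e) 0 i - c 0 i * x 0 i.
  by move=> /(_ i) /andP[x0 x1]; rewrite !mxE; case: (i \in e) => /=; lra.
exists c; apply/seteqP; split => [x ->|x [cx hx]].
  split=> [|y cy]; first exact: unit_cube_pt.
  by rewrite -subr_ge0 -sumrB; apply: sumr_ge0 => i _; apply: ge0.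
have := hx _ (unit_cube_pt e); rewrite -subr_le0 -sumrB => le0.
apply/rowP => i; have /eqP : \sum_(i < d) (c 0 i * (cube_pt e) 0 i - c 0 i * x 0 i) = 0.
  by apply/eqP; rewrite eq_le le0 sumr_ge0 // => j _; apply: ge0.
rewrite psumr_eq0 => [/allP/(_ i (mem_index_enum _))|j _]; last exact: ge0.
by move=> /eqP; rewrite !mxE; case: (i \in e) => /=; lra.
Qed.

Lemma face_cube_facet i b : face cube (cube_facet i b).
Proof.
pose c : 'rV[R]_d := (-1) ^+ (~~ b) *: delta_mx 0 i.
have cE x : dotp c x = (-1) ^+ (~~ b) * x 0 i.
  rewrite dotpZl /dotp (bigD1 i) //= big1 ?addr0.
    by rewrite mxE !eqxx mul1r.
  by move=> j ji; rewrite mxE (negPf ji) andbF mul0r.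
exists c; apply/seteqP; split => [x [cx xi]|x [cx hx]]; split => //.
  by move=> y /(_ i) /andP[y0 y1]; rewrite !cE xi; case: b {c cE xi} => /=; lra.
(* [[set j | b]] is the full or the empty set, so all coordinates of its vertex equal [b], in
   particular coordinate [i]. *)
have := hx _ (unit_cube_pt [set j : 'I_d | b]%SET).
rewrite !cE mxE; have /andP[] := cx i.
by case: b {c cE hx}; rewrite inE /=; lra.
Qed.

Lemma face_cube_mem F : face cube F -> exists e, F (cube_pt e).
Proof.
move=> [c ->]; exists [set i | 0 < c 0 i]%SET; split; first exact: unit_cube_pt.
move=> y cy; apply: ler_sum => i _; rewrite !mxE inE.
have /andP[y0 y1] := cy i.
by have [c0|c0] := ltP 0 (c 0 i); rewrite /=; nra.
Qed.

Lemma cube_facet_mem e i b : cube_facet i b (cube_pt e) <-> (i \in e) = b.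
Proof.
rewrite /cube_facet /= mxE; split => [[_ /eqP]|->]; last by split => //; exact: unit_cube_pt.
by rewrite eqr_nat; case: (i \in e) b => [] [].
Qed.

(** A functional maximal on the whole facet is unchanged by flips of the other coordinates, so it
    only involves coordinate [i]. Stated by inclusions alone, this maximality passes through a face
    poset isomorphism. *)
Lemma cube_facet_maximal i b F :
  face cube F -> cube_facet i b `<=` F ->
  F `<=` cube_facet i b \/ cube `<=` F.
Proof.
move=> [c ->] sub.
pose e := [set j : 'I_d | b]%SET.
have ie : (i \in e) = b by rewrite inE.
have cj j : j != i -> c 0 j = 0.
  move=> ji; have [_ h1] := sub _ (proj2 (cube_facet_mem e i b) ie).
  have ie' : (i \in flip j e) = b by rewrite in_flip eq_sym (negPf ji) addbF.
  have [_ h2] := sub _ (proj2 (cube_facet_mem _ i b) ie').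
  have := h1 _ (unit_cube_pt (flip j e)); have := h2 _ (unit_cube_pt e).
  by rewrite dotp_cube_pt_flip; case: (j \in e); rewrite /= ?expr1 ?expr0; lra.
have cE x : dotp c x = c 0 i * x 0 i.
  by rewrite /dotp (bigD1 i) //= big1 ?addr0 // => j /cj ->; rewrite mul0r.
have [ci|ci] := eqVneq (c 0 i) 0.
  by right => x cx; split => // y _; rewrite !cE ci !mul0r.
left => x [cx hx]; split => //.
have [ce he] := sub _ (proj2 (cube_facet_mem e i b) ie).
have := hx _ ce; have := he _ cx; rewrite !cE mxE ie => h1 h2.
by apply: (mulfI ci); apply/eqP; rewrite eq_le h1 h2.
Qed.

End UnitCube.

Arguments cube_pt {R d} e.
Arguments cube_facet {R d} i b.

(** * Labelling the vertices and facet normals of a smooth cube *)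

Section CubeStructure.
Variables (R : realType) (d : nat).
Implicit Types (e : {set 'I_d}) (i j k : 'I_d) (b : bool).
Implicit Types (V : seq 'rV[R]_d) (P F : set 'rV[R]_d) (c v w x y : 'rV[R]_d).
Implicit Types (u n : {set 'I_d} -> 'I_d -> 'rV[R]_d).
Local Notation cube := (@unit_cube R d).

(* [n e k] are the inner normals of the facets at the vertex [v e]. *)
Definition cube_vertices n V (v : {set 'I_d} -> 'rV[R]_d) : Prop :=
  [/\ forall e, v e \in V,
      forall e k x, conv V x -> 0 <= dotp (n e k) (x - v e) &
      forall c, exists e, forall x, conv V x -> dotp c x <= dotp c (v e)].

(** The functional [c] of [F] is nonpositive on all [u i] and nonzero on some [u k], as [F] is
    proper. Hence [F] lies in the face where [n k] vanishes, and maximality makes them equal: that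
    face misses a point on the ray of [u k]. *)
Lemma maximal_face_facet V v F (n u : 'I_d -> 'rV[R]_d) :
  dual_bases n u -> (forall x k, conv V x -> 0 <= dotp (n k) (x - v)) ->
  (forall i, exists p t, [/\ conv V p, 0 < t & p - v = t *: u i]) ->
  face (conv V) F -> F v -> ~ (conv V `<=` F) ->
  (forall F', face (conv V) F' -> F `<=` F' -> F' `<=` F \/ conv V `<=` F') ->
  exists k, forall x, F x <-> conv V x /\ dotp (n k) (x - v) = 0.
Proof.
move=> [nu span] pos pts [c FE] Fv Fproper Fmax; rewrite {}FE in Fv Fproper Fmax *.
case: Fv => Vv hv.
have cu i : dotp c (u i) <= 0.
  have [p [t [Vp t0 e]]] := pts i; have := hv _ Vp.
  by rewrite -subr_le0 -dotpBr e dotpZr pmulr_rle0.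
have cE x : dotp c (x - v) = \sum_i dotp (n i) (x - v) * dotp c (u i).
  by rewrite {1}[x - v]span dotp_sumr; apply: eq_bigr => i _; rewrite dotpZr.
have [k ck] : exists k, dotp c (u k) != 0.
  apply: contrapT => /forallNP c0; apply: Fproper => x Vx; split => // y Vy.
  have z y' : dotp c (y' - v) = 0.
    rewrite cE big1 // => i _; suff -> : dotp c (u i) = 0 by rewrite mulr0.
    by apply/eqP/negPn/negP/c0.
  by have := z y; have := z x; rewrite !dotpBr; lra.
exists k; pose H : set 'rV[R]_d := [set x | conv V x /\ dotp (n k) (x - v) = 0].
have HF : face (conv V) H.
  exists (- n k); apply/seteqP; split => [x [Vx hx]|x [Vx hx]]; split => //.
    move=> y Vy; have := pos y k Vy; move: hx; rewrite !dotpBr !dotpNl; lra.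
  have := hx _ Vv; have := pos x k Vx; rewrite !dotpBr !dotpNl => *.
  by apply/eqP; rewrite eq_le; apply/andP; split; lra.
have FH : [set x | conv V x /\ forall y, conv V y -> dotp c y <= dotp c x] `<=` H.
  move=> x [Vx hx]; split => //.
  have c0 : dotp c (x - v) = 0.
    by apply/eqP; rewrite dotpBr subr_eq0 eq_le hv // hx.
  have /eqP : \sum_i - (dotp (n i) (x - v) * dotp c (u i)) = 0.
    by rewrite sumrN -cE c0 oppr0.
  rewrite psumr_eq0 => [/allP/(_ k (mem_index_enum _))|i _].
    by rewrite oppr_eq0 mulf_eq0 (negPf ck) orbF => /eqP.
  by rewrite oppr_ge0 mulr_ge0_le0 // pos.
have [HsubF|] := Fmax H HF FH.
  by move=> x; split => [/FH|/HsubF].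
have [p [t [Vp t0 e]]] := pts k.
move=> /(_ p Vp)[_]; rewrite e dotpZr nu eqxx mulr1 => t00.
by move: t0; rewrite t00 ltxx.
Qed.

(** The poset isomorphism carries the labels of cube vertices and facets over to the polytope; at
    each vertex the local basis is then renumbered so that index [k] belongs to the facet of
    coordinate [k]. *)
Lemma smooth_cube_vertices V :
  smooth (conv V) -> comb_cube (conv V) -> V != [::] ->
  exists n u (v : {set 'I_d} -> 'rV[R]_d), [/\ cube_vertices n V v,
    forall e, vertex (conv V) (v e), forall e, dual_lattice_bases (n e) (u e) &
    forall e e' k, (dotp (n e k) (v e' - v e) == 0) = ((k \in e') == (k \in e))].
Proof.
move=> sm [f [fface [fsurj fle]]] Vn0; set P := conv V in fface fsurj fle *.
have /choice[v hv] e : exists v, vertex P v /\ f [set v] = [set cube_pt e].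
  have [F PF fF] := fsurj _ (@face_cube_pt R d e).
  have [c FE] := PF; have [w [wV wvert wmax]] := face_attains_vertex c Vn0.
  exists w; split => //.
  (* The image of a vertex [w] of [F] is a face inside a single point; as faces of the cube are
     nonempty, it is that point. *)
  have wF : [set w] `<=` F.
    by move=> _ ->; rewrite FE; split => //; exact: mem_conv.
  have := (fle _ _ wvert PF).1 wF; rewrite fF => sub.
  apply/seteqP; split => // _ ->.
  have [e' he'] := face_cube_mem (fface _ wvert).
  by rewrite -(sub _ he').
have vvert e := (hv e).1; have fv e := (hv e).2.
have /choice[G' hG'] (ib : 'I_d * bool) :
    exists F, face P F /\ f F = cube_facet ib.1 ib.2.
  by have [F PF fF] := fsurj _ (@face_cube_facet R d ib.1 ib.2); exists F.
pose G i b := G' (i, b).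
have Gface i b : face P (G i b) := (hG' (i, b)).1.
have fG i b : f (G i b) = cube_facet i b := (hG' (i, b)).2.
have Gv i b e : G i b (v e) <-> (i \in e) = b.
  rewrite -(@cube_facet_mem R d) -fG.
  split => [h|h].
    by apply: (fle _ _ (vvert e) (Gface i b)).1 => [x ->//|]; rewrite fv.
  by apply: (fle _ _ (vvert e) (Gface i b)).2 => //; rewrite fv => x ->.
have PP : face P P.
  by exists 0; apply/seteqP; split => [x Px|x []//]; split => // y _; rewrite !dotp0l.
have fP : cube `<=` f P.
  have [F PF <-] : exists2 F, face P F & f F = cube.
    apply: fsurj; exists 0; apply/seteqP; split => [x Px|x []//].
    by split => // y _; rewrite !dotp0l.
  by apply: (fle _ _ PF PP).1; case: PF => c -> x [].
have vP e : P (v e) by apply/mem_conv/vertex_mem/vvert.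
have /choice[un hun] e : exists un : ('I_d -> 'rV[R]_d) * ('I_d -> 'rV[R]_d),
    [/\ dual_lattice_bases un.2 un.1,
      forall x k, P x -> 0 <= dotp (un.2 k) (x - v e) &
      forall x k, G k (k \in e) x <-> P x /\ dotp (un.2 k) (x - v e) = 0].
  have [n [u [[nu ul ni] pos pts]]] := smooth_vertex sm (vvert e).
  have /choice[p hp] k : exists k', forall x, G k (k \in e) x <->
      P x /\ dotp (n k') (x - v e) = 0.
    apply: (maximal_face_facet nu pos pts (Gface _ _)).
    - exact/Gv.
    - move=> /(_ _ (vP (flip k e))) /Gv.
      by rewrite in_flip eqxx; case: (k \in e).
    - move=> F' PF' sub; have := (fle _ _ (Gface _ _) PF').1 sub.
      rewrite fG => /(cube_facet_maximal (fface _ PF')) [] h; [left|right].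
        by apply: (fle _ _ PF' (Gface _ _)).2; rewrite fG.
      apply: (fle _ _ PP PF').2; apply: subset_trans h.
      by have [c ->] := fface _ PP; move=> x [].
  (* The neighbour across direction [j] leaves facet [j] but stays on facet [i], so these two facets
     have different normals. *)
  have p_inj : injective p.
    move=> i j pij; apply/eqP/negPn/negP => ij.
    have : G i (i \in e) (v (flip j e)) by apply/Gv; rewrite in_flip (negPf ij) addbF.
    move=> /hp; rewrite pij => /hp /Gv.
    by rewrite in_flip eqxx; case: (j \in e).
  exists (u \o p, n \o p); split => //=; last by move=> x k Px; apply: pos.
  split=> [|k|k]; [|exact: ul|exact: ni].
  case: nu => nu span; split=> [i j|x] /=; first by rewrite nu (inj_eq p_inj).
  by rewrite {1}[x]span (reindex p) //; apply: onW_bij; apply: injF_bij.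
exists (fun e => (un e).2), (fun e => (un e).1), v; split.
- split => [e|e k x|c]; first exact/vertex_mem/vvert.
    by have [_ h _] := hun e; exact: h.
  pose F : set 'rV[R]_d := [set x | P x /\ forall y, P y -> dotp c y <= dotp c x].
  have PF : face P F by exists c.
  have [e he] := face_cube_mem (fface _ PF); exists e.
  have : F (v e); last by move=> [].
  by apply: (fle _ _ (vvert e) PF).2 => //; rewrite fv => x ->.
- exact: vvert.
- by move=> e; have [] := hun e.
- move=> e e' k; have [_ _ h] := hun e.
  apply/eqP/eqP => [h0|/Gv/h[]//].
  by apply/Gv/h.
Qed.

(** The normal cone of [v e] is also that of a face of the second polytope, and a generator in this
    face serves as [v' e]. The vectors [- n e k] lie in the cone, and these cones cover all
    functionals. *)
Lemma minkowski_equiv_cube_vertices n V V' (v : {set 'I_d} -> 'rV[R]_d) :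
  cube_vertices n V v -> V' != [::] ->
  (forall e, vertex (conv V) (v e)) ->
  minkowski_equiv (conv V) (conv V') ->
  exists v' : {set 'I_d} -> 'rV[R]_d, cube_vertices n V' v'.
Proof.
move=> [vV pos vmax] V'n0 vvert fan.
have /choice[v' hv'] e : exists v', v' \in V' /\
    forall c, normal_cone (conv V) [set v e] c ->
    forall x, conv V' x -> dotp c x <= dotp c v'.
  have : normal_fan (conv V) (normal_cone (conv V) [set v e]) by exists [set v e] => //; exact: vvert.
  rewrite fan => -[F [c FE] NE].
  have [w [wV _ wmax]] := face_attains_vertex c V'n0.
  exists w; split => // c'; rewrite NE => /(_ w); apply.
  by rewrite FE; split => //; exact: mem_conv.
exists v'; split => [e|e k x Vx|c]; first by case: (hv' e).
  have := (hv' e).2 (- n e k) _ x Vx; rewrite !dotpNl lerN2 dotpBr subr_ge0.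
  apply=> _ -> y Vy; rewrite !dotpNl lerN2 -subr_ge0 -dotpBr.
  exact: pos.
have [e he] := vmax c; exists e => x Vx.
by apply: (hv' e).2 => // _ ->.
Qed.

End CubeStructure.

(** * One normal per facet, and the normal of the opposite facet *)

Section FacetNormals.
Variables (R : realType) (d : nat).
Implicit Types (e : {set 'I_d}) (i j k : 'I_d) (b : bool).
Implicit Types (V : seq 'rV[R]_d) (c w x y : 'rV[R]_d).
Implicit Types (u n : {set 'I_d} -> 'I_d -> 'rV[R]_d) (v : {set 'I_d} -> 'rV[R]_d).

Lemma int_gt0_ge1 (m : R) : m \is a Num.int -> 0 < m -> 1 <= m.
Proof. by move=> /intrP[a ->]; rewrite ltr0z gtz0_ge1 -(ler_int R). Qed.

Lemma int_ge0_mul1 (m m' : R) :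
  m \is a Num.int -> m' \is a Num.int -> 0 <= m -> 0 <= m' -> m * m' = 1 -> m = 1.
Proof.
move=> mi m'i m0 m'0 mm'.
have [m1 m'1] : m != 0 /\ m' != 0.
  by split; apply/eqP => z; move/eqP: mm'; rewrite z ?mul0r ?mulr0 eq_sym oner_eq0.
have := int_gt0_ge1 mi; have := int_gt0_ge1 m'i.
by rewrite !lt_def m1 m'1 m0 m'0 => /(_ isT) h1 /(_ isT) h2; nra.
Qed.

Lemma dotp_ext c w : (forall x, dotp c x = dotp w x) -> c = w.
Proof.
move=> cw; apply/eqP; rewrite -subr_eq0; apply/eqP/dotp_self_eq0.
by rewrite dotpBl cw subrr.
Qed.

Lemma dual_bases_supp (n u : 'I_d -> 'rV[R]_d) k x :
  dual_bases n u -> (forall j, j != k -> dotp (n j) x = 0) ->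
  x = dotp (n k) x *: u k.
Proof.
move=> [_ span] h; rewrite {1}[x]span (bigD1 k) //= big1 ?addr0 // => j /h ->.
by rewrite scale0r.
Qed.

(** Neighbouring vertices share all facets at [e] but the one of coordinate [i], so only that dual
    coordinate of their difference survives. *)
Lemma cube_edge n u V v e i :
  cube_vertices n V v -> (forall e, dual_lattice_bases (n e) (u e)) ->
  (forall e e' k, (dotp (n e k) (v e' - v e) == 0) = ((k \in e') == (k \in e))) ->
  exists2 t, 0 < t & v (flip i e) - v e = t *: u e i.
Proof.
move=> [vV pos _] nu inc; have [nue _ _] := nu e.
exists (dotp (n e i) (v (flip i e) - v e)).
  rewrite lt_def inc in_flip eqxx addbT pos ?andbT; first by case: (i \in e).
  exact/mem_conv.
apply: (dual_bases_supp nue) => j ji; apply/eqP.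
by rewrite inc in_flip (negPf ji) addbF.
Qed.

(** Along the edges at [e] other than the [k]-th one stays on the common facet, so [n e' k] is a
    multiple of [n e k]. The multipliers in both directions are nonnegative integers with product
    1. *)
Lemma facet_normal_eq n u V v e e' k :
  cube_vertices n V v -> (forall e, dual_lattice_bases (n e) (u e)) ->
  (forall e e' k, (dotp (n e k) (v e' - v e) == 0) = ((k \in e') == (k \in e))) ->
  (k \in e) = (k \in e') -> n e k = n e' k.
Proof.
move=> cv nu inc kee'; have [vV pos _] := cv.
have mult e1 e2 : (k \in e1) = (k \in e2) ->
    0 <= dotp (n e2 k) (u e1 k) /\
    forall x, dotp (n e2 k) x = dotp (n e1 k) x * dotp (n e2 k) (u e1 k).
  move=> k12; have [[_ span] _ _] := nu e1.
  have diff e3 : dotp (n e2 k) (v e3 - v e1) = dotp (n e2 k) (v e3 - v e2).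
    have /eqP : dotp (n e2 k) (v e1 - v e2) == 0 by rewrite inc k12.
    by rewrite !dotpBr; lra.
  split=> [|x].
    have [t t0 et] := cube_edge e1 k cv nu inc.
    have := pos e2 k _ (mem_conv (vV (flip k e1))).
    by rewrite -diff et dotpZr pmulr_rge0.
  rewrite {1}[x]span dotp_sumr (bigD1 k) //= dotpZr big1 ?addr0 // => j jk.
  have [t t0 et] := cube_edge e1 j cv nu inc.
  have /eqP : dotp (n e2 k) (v (flip j e1) - v e1) == 0.
    by rewrite diff inc in_flip [k == j]eq_sym (negPf jk) addbF k12.
  rewrite et !dotpZr => /eqP; rewrite mulf_eq0 (gt_eqF t0) /= => /eqP ->.
  by rewrite mulr0.
have [m0 mE] := mult e e' kee'; have [m'0 _] := mult e' e (esym kee').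
have [[ne _] ul ni] := nu e; have [[ne' _] ul' ni'] := nu e'.
have m1 : dotp (n e' k) (u e k) = 1.
  apply: (@int_ge0_mul1 _ (dotp (n e k) (u e' k))) => //; [exact/ni'/ul|exact/ni/ul'|].
  by rewrite mulrC -mE ne' eqxx.
by apply: dotp_ext => x; rewrite mE m1 mulr1.
Qed.

(** Traversing the edge from both ends gives [t * m = - t'] and [t' * m' = - t], so [m] and [m'] are
    nonpositive integers with product 1. *)
Lemma opposite_normal n u V v e i :
  cube_vertices n V v -> (forall e, dual_lattice_bases (n e) (u e)) ->
  (forall e e' k, (dotp (n e k) (v e' - v e) == 0) = ((k \in e') == (k \in e))) ->
  dotp (n (flip i e) i) (u e i) = -1.
Proof.
move=> cv nu inc; have [t t0 et] := cube_edge e i cv nu inc.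
have [t' t'0] := cube_edge (flip i e) i cv nu inc; rewrite flipK => et'.
have [[ne _] ul ni] := nu e; have [[ne' _] ul' ni'] := nu (flip i e).
set m := dotp _ _; pose m' := dotp (n e i) (u (flip i e) i).
have mt : t * m = - t'.
  by rewrite /m -dotpZr -et -opprB et' dotpNr dotpZr ne' eqxx mulr1.
have m't : t' * m' = - t.
  by rewrite /m' -dotpZr -et' -opprB et dotpNr dotpZr ne eqxx mulr1.
suff : - m = 1 by lra.
apply: (@int_ge0_mul1 _ (- m')).
- by rewrite rpredN; apply/ni'/ul.
- by rewrite rpredN; apply/ni/ul'.
- by rewrite oppr_ge0 -(pmulr_rle0 _ t0) mt oppr_le0 ltW.
- by rewrite oppr_ge0 -(pmulr_rle0 _ t'0) m't oppr_le0 ltW.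
- have tt' : t * t' != 0 by rewrite mulf_neq0 // gt_eqF.
  by apply: (mulfI tt'); rewrite mulrNN mulr1 mulrACA mt m't mulrNN mulrC.
Qed.

(* [nu i b] is the inner normal of the facet corresponding to
   the facet [x_i = b] of the unit cube, [u e i] the edge
   direction at the vertex [e] along which coordinate [i] changes. *)
Definition cube_normals (nu : 'I_d -> bool -> 'rV[R]_d) u : Prop :=
  (forall e, dual_lattice_bases (fun i => nu i (i \in e)) (u e)) /\
  (forall e i, dotp (nu i (i \notin e)) (u e i) = -1).

Lemma exists_cube_normals n u V v :
  cube_vertices n V v -> (forall e, dual_lattice_bases (n e) (u e)) ->
  (forall e e' k, (dotp (n e k) (v e' - v e) == 0) = ((k \in e') == (k \in e))) ->
  exists nu, cube_normals nu u /\ forall e k, n e k = nu k (k \in e).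
Proof.
move=> cv nu inc; exists (fun k b => n [set j | b]%SET k).
have nE e k : n e k = n [set j | k \in e]%SET k.
  by apply: (facet_normal_eq cv nu inc); rewrite inE.
split=> //; split=> [e|e i].
  have [[ne span] ul ni] := nu e.
  split=> // [|i]; last by rewrite -nE.
  by split=> [i j|x]; rewrite -?nE // {1}[x]span; apply: eq_bigr => i _; rewrite nE.
by rewrite -(opposite_normal e i cv nu inc) [n (flip i e) i]nE in_flip eqxx addbT.
Qed.

End FacetNormals.

(** * Triangular order of the coordinates *)

(** Read [r i j] as the absence of an arrow from [i] to [j]: sinks are removed one after another and
    listed in the order of removal. *)
Lemma elimination_order (T : finType) (r : T -> T -> Prop) :
  (forall I : {set T}, I != finset.set0 ->
    exists2 i, i \in I & forall j, j \in I -> j != i -> r i j) ->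
  exists s : seq T, [/\ uniq s, forall i, i \in s &
    forall s1 i s2, s = s1 ++ i :: s2 -> forall j, j \notin s1 -> j != i -> r i j].
Proof.
move=> sink; suff [s [us sT hs]] : exists s : seq T, [/\ uniq s, s =i [set: T]%SET &
    forall s1 i s2, s = s1 ++ i :: s2 ->
      forall j, j \in [set: T]%SET -> j \notin s1 -> j != i -> r i j].
  exists s; split => // [i|s1 i s2 es j]; first by rewrite sT inE.
  by apply: (hs _ _ _ es); rewrite inE.
move: [set: T]%SET => I; have [m] := ubnP #|I|; elim: m I => // m IH I cardI.
have [->|I0] := eqVneq I finset.set0.
  by exists [::]; split => // [i|[|k s1] i s2 //]; rewrite !inE.
have [i iI hi] := sink I I0.
have [|s [us sI hs]] := IH (I :\ i).
  by move: cardI; rewrite (cardsD1 i) iI.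
exists (i :: s); split => [|j|].
- by rewrite /= us sI !inE eqxx.
- by rewrite in_cons sI !inE; have [->|] := eqVneq j i.
- move=> [|k s1] i' s2 /= [<-] es j jI; first by move=> _; apply: hi.
  by rewrite in_cons negb_or => /andP[ji]; apply: (hs _ _ _ es); rewrite !inE ji.
Qed.

Section Order.
Variables (R : realType) (d : nat).
Implicit Types (e I : {set 'I_d}) (i j k : 'I_d) (b : bool) (x y : 'rV[R]_d).
Implicit Types (u : {set 'I_d} -> 'I_d -> 'rV[R]_d) (nu : 'I_d -> bool -> 'rV[R]_d).

(** The coefficients are the matrix of the normals [nu i true] in the basis of normals at the vertex
    with empty label. *)
Lemma cube_normals_expand nu u i x : cube_normals nu u ->
  dotp (nu i true) x =
  \sum_k dotp (nu k false) x * dotp (nu i true) (u finset.set0 k).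
Proof.
move=> [dual _]; have [[_ span] _ _] := dual finset.set0.
rewrite {1}[x]span dotp_sumr; apply: eq_bigr => k _.
by rewrite dotpZr finset.in_set0.
Qed.

Lemma cube_normals_diag nu u i : cube_normals nu u ->
  dotp (nu i true) (u finset.set0 i) = -1.
Proof. by move=> [_ /(_ finset.set0 i)]; rewrite finset.in_set0. Qed.

(* In a minimal [I] without sink every successor map is a chordless Hamiltonian
   cycle. Along it the edge direction at [I :\ i0] would have all coordinates
   zero, contradicting coordinate [i0] being 1. *)
Lemma cube_normals_sink nu u I : cube_normals nu u -> I != finset.set0 ->
  exists2 i, i \in I & forall j, j \in I -> j != i -> dotp (nu i true) (u finset.set0 j) = 0.
Proof.
move=> cn; pose A i j := dotp (nu i true) (u finset.set0 j).
have [m] := ubnP #|I|; elim: m I => // m IH I cardI I0; apply: contrapT => nosink.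
have /choice[f hf] i : exists j, i \in I -> [/\ j \in I, j != i & A i j != 0].
  have [iI|_] := boolP (i \in I); last by exists i.
  apply: contrapT => /forallNP h; apply: nosink; exists i => // j jI ji.
  by apply/eqP/negPn/negP => Aij; apply: (h j).
have fI i : i \in I -> f i \in I by move=> /hf[].
have Af i : i \in I -> A i (f i) != 0 by move=> /hf[].
(* The induction hypothesis makes [I] minimal: a nonempty subset closed under having successors
   cannot be smaller. *)
have min (J : {set 'I_d}) : J \subset I -> J != finset.set0 ->
    (forall i, i \in J -> exists j, [/\ j \in J, j != i & A i j != 0]) -> J = I.
  move=> JI J0 hJ; apply/eqP; rewrite eqEproper JI /=; apply/negP => pJ.
  have [|i iJ hi] := IH J _ J0; first exact: leq_trans (proper_card pJ) _.
  by have [j [jJ ji /eqP]] := hJ i iJ; apply; apply: hi.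
have minf (J : {set 'I_d}) : J \subset I -> J != finset.set0 ->
    (forall i, i \in J -> f i \in J) -> J = I.
  move=> JI J0 hJ; apply: min => // i iJ; exists (f i).
  by have [] := hf i (fintype.subsetP JI i iJ); split => //; apply: hJ.
have [i0 i0I] := finset.set0Pn _ I0.
have fimg : f @: I = I.
  apply: minf; first by apply/fintype.subsetP => _ /imsetP[i iI ->]; exact: fI.
    by apply/finset.set0Pn; exists (f i0); apply: imset_f.
  by move=> _ /imsetP[i iI ->]; apply/imset_f/fI.
have finj : {in I &, injective f} by apply/imset_injP; rewrite fimg.
(* With a second arrow from [i], the element [f i] could be dropped: [i] then uses [j], and by
   injectivity no other element is sent to [f i]. *)
have chord i j : i \in I -> j \in I -> j != i -> j != f i -> A i j = 0.
  move=> iI jI ji jf; apply/eqP/negPn/negP => Aij.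
  have /setP/(_ (f i)) : I :\ f i = I; last by rewrite !inE eqxx fI.
  apply: min; first exact: finset.subsetDl.
    by apply/finset.set0Pn; exists j; rewrite !inE jf.
  move=> k; rewrite !inE => /andP[kf kI].
  have [->|ki] := eqVneq k i; first by exists j; rewrite !inE jf jI.
  exists (f k); have [fkI fk Afk] := hf k kI; split => //.
  rewrite !inE fkI andbT; apply: contra_neq ki; exact: finj.
pose w := u (I :\ i0) i0; pose a j := dotp (nu j false) w.
have nuw j : dotp (nu j (j \in I :\ i0)) w = (j == i0)%:R.
  by have [[nuw _] _ _] := cn.1 (I :\ i0); exact: nuw.
have aI j : j \notin I -> a j = 0.
  move=> jI; rewrite /a; have := nuw j; rewrite !inE (negPf jI) andbF => ->.
  by have [e|//] := eqVneq j i0; rewrite e i0I in jI.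
have a0 : a i0 = 1 by have := nuw i0; rewrite !inE eqxx.
have expand i : i \in I -> dotp (nu i true) w = - a i + a (f i) * A i (f i).
  move=> iI; have [_ fi _] := hf i iI.
  rewrite (cube_normals_expand i w cn) (bigD1 i) //= (bigD1 (f i)) //= big1.
    by rewrite (cube_normals_diag i cn) addr0 mulrN1.
  move=> j /andP[ji jf]; have [jI|/aI aj] := boolP (j \in I).
    by rewrite [X in _ * X]chord // mulr0.
  by rewrite -/(a j) aj mul0r.
(* In both cases [nu i true] takes the value [- a i] at [w]: it is -1 at [i0] and 0 elsewhere. So
   the arrow term of the expansion vanishes, and zeros propagate around the cycle. *)
have step i : i \in I -> (i == i0) || (a i == 0) -> a (f i) = 0.
  move=> iI h; suff /eqP : a (f i) * A i (f i) = 0.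
    by rewrite mulf_eq0 (negPf (Af i iI)) orbF => /eqP.
  suff wi : dotp (nu i true) w = - a i.
    by move: (expand i iI); rewrite wi -[LHS]addr0 => /addrI.
  have [->|ii0] := eqVneq i i0.
    by have := cn.2 (I :\ i0) i0; rewrite !inE eqxx /= -/w a0.
  by move: h (nuw i); rewrite !inE iI (negPf ii0) /= => /eqP -> ->; rewrite oppr0.
have /setP/(_ i0) : [set i in I | a i == 0]%SET = I.
  apply: minf; first by apply/fintype.subsetP => i; rewrite inE => /andP[].
    by apply/finset.set0Pn; exists (f i0); rewrite inE fI // step ?eqxx.
  by move=> i; rewrite !inE => /andP[iI ai]; rewrite fI // step ?ai ?orbT //=.
by rewrite inE i0I a0 oner_eq0.
Qed.

(** The diagonal entry -1 in the expansion of [nu i true] cancels [nu i false], so the sum involves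
    only coordinates in [s1]. It turns a lower bound on [nu i true] into an upper bound on
    [nu i false] that depends on earlier coordinates. *)
Lemma prefix_congr nu u (s1 : seq 'I_d) i x y : cube_normals nu u ->
  (forall j, j \notin s1 -> j != i -> dotp (nu i true) (u finset.set0 j) = 0) ->
  (forall k, k \in s1 -> dotp (nu k false) x = dotp (nu k false) y) ->
  dotp (nu i true) x + dotp (nu i false) x =
  dotp (nu i true) y + dotp (nu i false) y.
Proof.
move=> cn ord xy.
suff h z : dotp (nu i true) z + dotp (nu i false) z =
    \sum_(k | k != i) dotp (nu k false) z * dotp (nu i true) (u finset.set0 k).
  rewrite !h; apply: eq_bigr => k ki; have [ks|ks] := boolP (k \in s1).
    by rewrite xy.
  by rewrite ord // !mulr0.
rewrite (cube_normals_expand i z cn) (bigD1 i) //= (cube_normals_diag i cn).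
by rewrite mulrN1 addrAC addNr add0r.
Qed.

End Order.

(** * Support numbers and extension of prefixes *)

Section Fibres.
Variables (R : realType) (d : nat).
Implicit Types (e : {set 'I_d}) (i j k : 'I_d) (b : bool).
Implicit Types (V : seq 'rV[R]_d) (c w p x y z : 'rV[R]_d) (s : seq 'I_d).
Implicit Types (u : {set 'I_d} -> 'I_d -> 'rV[R]_d) (nu : 'I_d -> bool -> 'rV[R]_d).
Implicit Types (v : {set 'I_d} -> 'rV[R]_d).

Definition triangular_order nu u s : Prop :=
  forall s1 i s2, s = s1 ++ i :: s2 -> forall j, j \notin s1 -> j != i ->
  dotp (nu i true) (u finset.set0 j) = 0.

(** The numbers [h i b] are the support numbers for the inner normals, as minima. *)
Definition cube_support nu V v (h : 'I_d -> bool -> R) : Prop :=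
  (forall i b x, conv V x -> h i b <= dotp (nu i b) x) /\
  (forall e i, dotp (nu i (i \in e)) (v e) = h i (i \in e)).

Lemma exists_cube_support n nu V v :
  cube_vertices n V v -> (forall e k, n e k = nu k (k \in e)) ->
  exists h, cube_support nu V v h.
Proof.
move=> [vV pos _] nE; pose e0 b : {set 'I_d} := [set j | b]%SET.
have le e k x : conv V x -> dotp (nu k (k \in e)) (v e) <= dotp (nu k (k \in e)) x.
  by move=> Vx; rewrite -subr_ge0 -dotpBr -nE pos.
exists (fun i b => dotp (nu i b) (v (e0 b))); split => [i b x Vx|e i].
  by have := le (e0 b) i x Vx; rewrite !inE.
apply/eqP; rewrite eq_le le /=; last exact/mem_conv.
by have := le (e0 (i \in e)) i _ (mem_conv (vV e)); rewrite !inE.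
Qed.

(** When all coordinates before [k] vanish on the edge direction, [nu k true] and [nu k false] are
    opposite there; the one belonging to [e] is zero by duality, hence both are. *)
Lemma edge_prefix0 nu u s s1 s2 i e : cube_normals nu u -> triangular_order nu u s ->
  s = s1 ++ s2 -> i \notin s1 -> forall j, j \in s1 -> dotp (nu j false) (u e i) = 0.
Proof.
move=> cn ord; elim/last_ind: s1 s2 => // s1 k IH s2.
rewrite cat_rcons mem_rcons in_cons negb_or => es /andP[ik is1].
have {}IH := IH _ es is1.
move=> j; rewrite mem_rcons in_cons => /orP[/eqP->|]; last exact: IH.
have xy j' : j' \in s1 -> dotp (nu j' false) (u e i) = dotp (nu j' false) 0.
  by rewrite dotp0r; exact: IH.
have := prefix_congr cn (ord _ _ _ es) xy; rewrite !dotp0r addr0.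
have [[nue _] _ _] := cn.1 e; have := nue k i.
by rewrite eq_sym (negPf ik); case: (k \in e) => ->; rewrite ?add0r.
Qed.

Section Polytope.
Variables (V : seq 'rV[R]_d) (n u : {set 'I_d} -> 'I_d -> 'rV[R]_d).
Variables (nu : 'I_d -> bool -> 'rV[R]_d) (v : {set 'I_d} -> 'rV[R]_d).
Variables (h : 'I_d -> bool -> R) (s : seq 'I_d).
Hypothesis cv : cube_vertices n V v.
Hypothesis cn : cube_normals nu u.
Hypothesis ord : triangular_order nu u s.
Hypothesis us : uniq s.
Hypothesis sup : cube_support nu V v h.

(* Move every vertex along its edge in direction [i]. *)
Lemma fibre_meets_facet s1 i s2 b x : s = s1 ++ i :: s2 -> conv V x ->
  exists x', [/\ conv V x', dotp (nu i b) x' = h i b &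
    forall k, k \in s1 -> dotp (nu k false) x' = dotp (nu k false) x].
Proof.
move=> es Vx; have [vV pos vmax] := cv.
have is1 : i \notin s1 by move: us; rewrite es cat_uniq /= => /and3P[_ /norP[]].
(* The points whose fibre over the prefix [s1] meets the facet form a convex set, so it suffices to
   find every vertex in it. *)
pose K : set 'rV[R]_d := [set x | exists x', [/\ conv V x', dotp (nu i b) x' = h i b &
    forall k, k \in s1 -> dotp (nu k false) x' = dotp (nu k false) x]].
apply: (@convex_separation _ _ [seq v e | e <- enum {: {set 'I_d}}] K).
- move=> y z t t01 [y' [Vy' hy' ky']] [z' [Vz' hz' kz']].
  exists ((1 - t) *: y' + t *: z'); split; first exact: conv_convex.
    by rewrite !dotpE hy' hz'; ring.
  by move=> k ks; rewrite !dotpE ky' ?kz'.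
- move=> _ /mapP[e _ ->]; have [eb|eb] := eqVneq (i \in e) b.
    by exists (v e); split => //; [exact: mem_conv|rewrite -eb sup.2].
  exists (v (flip i e)); split; first exact: mem_conv.
    have -> : b = (i \in flip i e) by rewrite in_flip eqxx; move: eb; clear; case: (i \in e); case: b.
    exact: sup.2.
  have [dual _ _] := cn.1 e.
  have ed : v (flip i e) - v e = dotp (nu i (i \in e)) (v (flip i e) - v e) *: u e i.
    apply: (dual_bases_supp dual) => j ji.
    have -> : (j \in e) = (j \in flip i e) by rewrite in_flip (negPf ji) addbF.
    by rewrite dotpBr sup.2 in_flip (negPf ji) addbF sup.2 subrr.
  move=> k ks; apply/eqP; rewrite -subr_eq0 -dotpBr ed dotpZr.
  by rewrite (edge_prefix0 e cn ord es is1) // mulr0.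
- move=> c; have [e he] := vmax c; exists (v e); last exact: he.
  by apply: map_f; rewrite mem_enum.
Qed.

(** Over a prefix already realized, the fibre reaches both facets of the next coordinate; the
    prescribed value lies between theirs and is obtained by interpolation. *)
Lemma prefix_extends s1 s2 p : s = s1 ++ s2 ->
  (forall i b, i \in s1 -> h i b <= dotp (nu i b) p) ->
  exists2 x, conv V x & forall k, k \in s1 -> dotp (nu k false) x = dotp (nu k false) p.
Proof.
elim/last_ind: s1 s2 => [|s1 i IH] s2 es hp.
  by have [vV _ _] := cv; exists (v finset.set0) => //; exact/mem_conv.
rewrite cat_rcons in es.
have [|x Vx xp] := IH _ es.
  by move=> j b js; apply: hp; rewrite mem_rcons in_cons js orbT.
have [x0 [Vx0 hx0 kx0]] := fibre_meets_facet false es Vx.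
have [x1 [Vx1 hx1 kx1]] := fibre_meets_facet true es Vx.
have hpi b : h i b <= dotp (nu i b) p by apply: hp; rewrite mem_rcons mem_head.
have xp1 k : k \in s1 -> dotp (nu k false) x1 = dotp (nu k false) p.
  by move=> ks; rewrite kx1 ?xp.
have := prefix_congr cn (ord es) xp1.
have := hpi true; have := hpi false; rewrite -hx0 -hx1.
set a := dotp (nu i false) p; set a0 := dotp (nu i false) x0.
move=> a0a b1 eq1; have aa1 : a <= dotp (nu i false) x1 by lra.
(* If the two facets meet in this fibre, the interpolation would divide by zero, but [x0] already
   has the right value. *)
have [e01|ne01] := eqVneq a0 (dotp (nu i false) x1).
  exists x0 => // k; rewrite mem_rcons in_cons => /orP[/eqP->|ks].
    by apply/eqP; rewrite -/a0 -/a eq_le a0a e01.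
  by rewrite kx0 // xp.
have lt01 : a0 < dotp (nu i false) x1 by rewrite lt_def eq_sym ne01 (le_trans a0a).
pose t := (a - a0) / (dotp (nu i false) x1 - a0).
exists ((1 - t) *: x0 + t *: x1).
  apply: conv_convex => //; rewrite divr_ge0 ?subr_ge0 ?(ltW lt01) //=.
  by rewrite ler_pdivrMr ?subr_gt0 // mul1r lerD2r.
move=> k; rewrite mem_rcons in_cons => /orP[/eqP->|ks].
  by rewrite !dotpE -/a0 -/a /t; field; rewrite subr_eq0 eq_sym.
by rewrite !dotpE kx0 // kx1 // xp //; ring.
Qed.

(** The interval left for coordinate [i] is nonempty because a point of the polytope lies over the
    prefix of [p]. *)
Lemma prefix_gap s1 i s2 p : s = s1 ++ i :: s2 ->
  (forall j b, j \in s1 -> h j b <= dotp (nu j b) p) ->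
  h i true + h i false <= dotp (nu i true) p + dotp (nu i false) p.
Proof.
move=> es /(prefix_extends es)[x Vx xp].
rewrite -(prefix_congr cn (ord es) xp); apply: lerD; exact: sup.1.
Qed.

End Polytope.
End Fibres.

(** * Greedy decomposition of a lattice point of the sum *)

Section Decomposition.
Variables (R : realType) (d : nat).
Implicit Types (e : {set 'I_d}) (i j k : 'I_d) (b : bool).
Implicit Types (V : seq 'rV[R]_d) (p x y z : 'rV[R]_d) (s : seq 'I_d).
Implicit Types (u : {set 'I_d} -> 'I_d -> 'rV[R]_d) (nu : 'I_d -> bool -> 'rV[R]_d).
Implicit Types (v : {set 'I_d} -> 'rV[R]_d).

Lemma lattice_ptD x y : lattice_pt x -> lattice_pt y -> lattice_pt (x + y).
Proof. by move=> lx ly i; rewrite mxE rpredD. Qed.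

Lemma lattice_ptZ (t : R) x : t \is a Num.int -> lattice_pt x -> lattice_pt (t *: x).
Proof. by move=> ti lx i; rewrite mxE rpredM. Qed.

Lemma cube_normals_integral nu u i b : cube_normals nu u -> integral_form (nu i b).
Proof.
by move=> cn; have [_ _ /(_ i)] := cn.1 [set j | b]%SET; rewrite inE.
Qed.

Lemma cube_support_int nu u V v h i b :
  cube_normals nu u -> cube_support nu V v h -> (forall e, lattice_pt (v e)) ->
  h i b \is a Num.int.
Proof.
move=> cn sup lv; have := sup.2 [set j | b]%SET i; rewrite inE => <-.
exact: cube_normals_integral cn _ (lv _).
Qed.

Lemma cube_pair_IDP n nu u s V V' v v' :
  cube_vertices n V v -> cube_vertices n V' v' ->
  (forall e k, n e k = nu k (k \in e)) -> cube_normals nu u ->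
  triangular_order nu u s -> uniq s -> (forall i, i \in s) ->
  (forall e, lattice_pt (v e)) -> (forall e, lattice_pt (v' e)) ->
  IDP_pair (conv V) (conv V').
Proof.
move=> cv cv' nE cn ord us sT lv lv' z lz [x [y [Vx [Vy zE]]]].
have [h sup] := exists_cube_support cv nE.
have [h' sup'] := exists_cube_support cv' nE.
(* The [nu k false] are coordinates, so agreement along all of [s] means equality. *)
have recover (P : set 'rV[R]_d) q : (exists2 x, P x &
    forall k, k \in s -> dotp (nu k false) x = dotp (nu k false) q) -> P q.
  move=> [x' Px' x'q]; suff <- : x' = q by [].
  have [[_ span] _ _] := cn.1 finset.set0.
  rewrite [x']span [q]span; apply: eq_bigr => k _.
  by rewrite finset.in_set0 x'q.
have ni i b : integral_form (nu i b) := cube_normals_integral i b cn.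
suff /(_ s [::]) : forall s1 s2, s = s1 ++ s2 -> exists2 p, lattice_pt p &
    forall i b, i \in s1 -> h i b <= dotp (nu i b) p /\ h' i b <= dotp (nu i b) (z - p).
  rewrite cats0 => /(_ erefl)[p lp hp]; exists p, (z - p); split => //.
  split; first by rewrite -scaleN1r; apply/lattice_ptD/lattice_ptZ; rewrite ?rpredN1.
  split; last split; last by rewrite addrC subrK.
    apply: recover; apply: (prefix_extends cv cn ord us sup (s2 := [::])).
      by rewrite cats0.
    by move=> i b /hp - /(_ b)[].
  apply: recover; apply: (prefix_extends cv' cn ord us sup' (s2 := [::])).
    by rewrite cats0.
  by move=> i b /hp - /(_ b)[].
elim/last_ind => [|s1 i IH] s2 es.
  by exists 0 => // j; rewrite mxE rpred0.
rewrite cat_rcons in es; have [p lp hp] := IH _ es.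
have is1 : i \notin s1 by move: us; rewrite es cat_uniq /= => /and3P[_ /norP[]].
have gap := prefix_gap cv cn ord us sup es (fun j b js => (hp j b js).1).
have gap' := prefix_gap cv' cn ord us sup' es (fun j b js => (hp j b js).2).
have sumz b : h i b + h' i b <= dotp (nu i b) z.
  by rewrite zE dotpDr lerD // ?sup.1 ?sup'.1.
(* [p] is to be shifted by [t] times [u finset.set0 i], on which [nu i false] is 1 and [nu i true]
   is -1. Of the four facet inequalities two bound [t] from below; their maximum is an integer. *)
pose t := Num.max (h i false - dotp (nu i false) p) (h' i true - dotp (nu i true) (z - p)).
have ti : t \is a Num.int.
  rewrite /t; case: leP => _; rewrite rpredB ?(cube_support_int _ _ cn sup) //.
  - exact: cube_support_int cn sup' lv'.
  - apply: ni; rewrite -scaleN1r; apply/lattice_ptD/lattice_ptZ => //.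
    by rewrite rpredN1.
  - exact: ni.
have [t1 t2] : h i false - dotp (nu i false) p <= t /\
    h' i true - dotp (nu i true) (z - p) <= t by rewrite /t !le_max !lexx orbT.
(* Each lower bound is compared with each upper bound: bounds from the same polytope by its gap,
   those from different ones because [z] lies in the sum. *)
have [t3 t4] : t <= dotp (nu i true) p - h i true /\
    t <= dotp (nu i false) (z - p) - h' i false.
  have := sumz true; have := sumz false; move: gap gap'.
  by rewrite /t !ge_max !dotpBr => *; split; apply/andP; split; lra.
pose w := u finset.set0 i; have [[nuw _] ul _] := cn.1 finset.set0.
exists (p + t *: w); first by apply/lattice_ptD/lattice_ptZ => //; exact: ul.
have nufw j : dotp (nu j false) w = (j == i)%:R.
  by rewrite -nuw finset.in_set0.
move=> j b; rewrite mem_rcons in_cons => /orP[/eqP->|js].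
  have nutw := cube_normals_diag i cn; rewrite -/w in nutw.
  have nufi : dotp (nu i false) w = 1 by rewrite nufw eqxx.
  move: t1 t2 t3 t4; clearbody t.
  by case: b; rewrite !dotpE ?nutw ?nufi => *; split; lra.
(* The shift keeps the earlier inequalities: [nu j false] vanishes on [w] by duality, [nu j true] by
   triangularity. *)
have jb : dotp (nu j b) w = 0.
  have ij : i != j by apply: contraNneq is1 => ->.
  case: b; last by rewrite nufw eq_sym (negPf ij).
  case/splitPr: js es is1 => s3 s4 es; rewrite mem_cat in_cons !negb_or.
  move=> /and3P[is3 _ is4]; apply: (ord s3 j (s4 ++ i :: s2)) => //.
  by rewrite es -catA.
have := hp j b js; rewrite opprD addrA !dotpBr dotpDr dotpZr jb mulr0 addr0 subr0.
by rewrite -dotpBr.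
Qed.

End Decomposition.

Theorem theorem4p7 (R : realType) (d : nat) (C C' : set 'rV[R]_d) :
  smooth C -> smooth C' -> comb_cube C -> comb_cube C' ->
  minkowski_equiv C C' -> IDP_pair C C'.
Proof.
move=> smC [[V' [latV' ->]] [[q0 [_ [Vq0 _]]] _]] cubeC _.
have [[V [latV CE]] [[p0 [_ [Vp0 _]]] _]] := smC.
rewrite {}CE in smC cubeC Vp0 * => fan.
have [n [u [v [cv vert dual inc]]]] := smooth_cube_vertices smC cubeC (conv_nonempty Vp0).
(* The common fan gives the second polytope the same labels and inner normals, so one family [nu]
   and one order [s] serve both. *)
have [v' cv'] := minkowski_equiv_cube_vertices cv (conv_nonempty Vq0) vert fan.
have [nu [cn nE]] := exists_cube_normals cv dual inc.
have [s [us sT ord]] := elimination_order (fun I => cube_normals_sink cn (I := I)).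
apply: (cube_pair_IDP cv cv' nE cn ord us sT) => e.
  by apply: latV; case: cv.
by apply: latV'; case: cv'.
Qed.
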